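(* There exists an absolute constant $c>0$ such that for every $n\in\mathbb{N}$, all real numbers $r,R>0$, and every convex polytope $P\subset\mathbb{R}^n$ satisfying $rB_2^n\subset P\subset RB_2^n$, $$\log|V|\cdot\log|\mathcal{F}|\cdot\left(\frac{R}{r}\right)^2\ \geq\ c\,n^2,$$ where $V$ is the set of vertices and $\mathcal{F}$ is the set of facets of $P$.
   Context: A polytope in $\mathbb{R}^n$ is the convex hull of finitely many points with non-empty interior. Vertices are its $0$-dimensional faces and facets are its $(n-1)$-dimensional faces. $B_2^n$ is the closed Euclidean unit ball in $\mathbb{R}^n$ centered at the origin. Logarithms are natural. *)

(* Defs.v *)
From HB Require Import structures.
From mathcomp Require Import all_boot all_order all_algebra finmap.
From mathcomp Require Import all_classical all_reals all_analysis.
Set Implicit Arguments.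
Unset Strict Implicit.
Unset Printing Implicit Defensive.
Import Order.TTheory GRing.Theory Num.Theory numFieldNormedType.Exports.
Local Open Scope classical_set_scope.
Local Open Scope ring_scope.

Section Polytope.
Variables (K : realType) (n : nat).
Implicit Types (A F P : set 'rV[K]_n) (u v x y : 'rV[K]_n).

Definition dotr u v : K := \sum_(i < n) u 0 i * v 0 i.

(* The norm `|x| that the library puts on 'rV[K]_n is the sup norm. *)
Definition enorm x : K := Num.sqrt (dotr x x).

Definition unit_ball : set 'rV[K]_n := [set x | enorm x <= 1].

Definition dilate (s : K) A : set 'rV[K]_n := [set s *: x | x in A].

Definition convex_hull A : set 'rV[K]_n := smallest (@convex_set K 'rV[K]_n) A.

(* The interior is taken in the product topology of 'rV[K]_n, which is also
   the Euclidean topology. *)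
Definition is_polytope P : Prop :=
  (exists2 S : set 'rV[K]_n, finite_set S & P = convex_hull S) /\
  interior P !=set0.

Definition affine_set A : Prop :=
  forall x y (t : K), A x -> A y -> A (t *: x + (1 - t) *: y).

Definition affine_hull A : set 'rV[K]_n := smallest affine_set A.

(* The empty set has no dimension in this sense (its dimension is -1). *)
Definition has_dim A (d : nat) : Prop :=
  exists x (W : {vspace 'rV[K]_n}),
    \dim W = d /\ affine_hull A = [set x + w | w in [set` W]].

(* The intersection of P with a supporting hyperplane; taking u = 0 gives the
   improper faces P and set0. *)
Definition is_face P F : Prop :=
  exists u (b : K), (forall x, P x -> dotr u x <= b) /\
    F = P `&` [set x | dotr u x = b].

Definition vertices P : set (set 'rV[K]_n) :=
  [set F | is_face P F /\ has_dim F 0].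

(* The dimension of a facet is d with d + 1 = n, so as not to truncate n - 1. *)
Definition facets P : set (set 'rV[K]_n) :=
  [set F | is_face P F /\ exists2 d : nat, d.+1 = n & has_dim F d].

End Polytope.

(* #|` fset_set A | is 0 when A is infinite. *)
Definition ncard (T : choiceType) (A : set T) : nat := #|` fset_set A|%fset.

(* Main.v *)
Require Import Defs.
From HB Require Import structures.
From mathcomp Require Import all_boot all_order all_algebra finmap.
From mathcomp Require Import all_classical all_reals all_analysis.
From mathcomp Require Import ring lra.
Set Implicit Arguments.
Unset Strict Implicit.
Unset Printing Implicit Defensive.
Import Order.TTheory GRing.Theory Num.Theory numFieldNormedType.Exports.
Local Open Scope classical_set_scope.
Local Open Scope ring_scope.

(** Write [V] for the vertex set of [P], [h e] for the maximum over [P] of the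
    linear form [dotr e], and let [Q] be the polar of [P], the set of all [u]
    with [dotr u x <= 1] on [P]. The point [(h e)^-1 *: e] lies in [Q], so the
    maximum [h' e] of [dotr e] over [Q] satisfies [h e * h' e >= dotr e e].
    For a sign vector [e] (all coordinates 1 or -1) the right-hand side is
    exactly [n], whatever the signs.

    Both maxima are attained on small finite sets. The maximum [h e] is attained
    at a vertex of [P], of norm at most [R] ([exists_vertex_max]). The maximum
    [h' e] is attained at an extreme point of [Q], of norm at most [1 / r]
    ([exists_polar_vertex]), and the extreme points of [Q] are the outer normals
    of distinct facets of [P] ([dual_face_facet], [polar_vertex_inj]). On the
    other hand, for a random sign vector [e] and a fixed [a], the number
    [dotr a e] is sub-Gaussian with parameter the norm of [a]; so, by a union
    bound, some [e] makes [dotr a e] at most of order [R * sqrt (ln #|V|)] for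
    all vertices [a], and simultaneously at most of order
    [sqrt (ln #|facets|) / r] for all facet normals
    ([exists_sign_vector_lt]). For that [e] the number [n] is at most the
    product of the two bounds, and squaring gives the theorem. *)

(** * The scalar product *)

Lemma dotrC (K : realType) (n : nat) (u v : 'rV[K]_n) : dotr u v = dotr v u.
Proof. by apply: eq_bigr => i _; rewrite mulrC. Qed.

Lemma dotrDl (K : realType) (n : nat) (u v w : 'rV[K]_n) :
  dotr (u + v) w = dotr u w + dotr v w.
Proof. by rewrite -big_split; apply: eq_bigr => i _; rewrite mxE mulrDl. Qed.

Lemma dotrZl (K : realType) (n : nat) (k : K) (u w : 'rV[K]_n) :
  dotr (k *: u) w = k * dotr u w.
Proof. by rewrite mulr_sumr; apply: eq_bigr => i _; rewrite mxE mulrA. Qed.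

Lemma dotrDr (K : realType) (n : nat) (u v w : 'rV[K]_n) :
  dotr w (u + v) = dotr w u + dotr w v.
Proof. by rewrite dotrC dotrDl !(dotrC _ w). Qed.

Lemma dotrZr (K : realType) (n : nat) (k : K) (u w : 'rV[K]_n) :
  dotr w (k *: u) = k * dotr w u.
Proof. by rewrite dotrC dotrZl (dotrC _ w). Qed.

Lemma dotrNl (K : realType) (n : nat) (u w : 'rV[K]_n) :
  dotr (- u) w = - dotr u w.
Proof. by rewrite -scaleN1r dotrZl mulN1r. Qed.

Lemma dotrNr (K : realType) (n : nat) (u w : 'rV[K]_n) :
  dotr w (- u) = - dotr w u.
Proof. by rewrite -scaleN1r dotrZr mulN1r. Qed.

Lemma dotr0l (K : realType) (n : nat) (w : 'rV[K]_n) : dotr 0 w = 0.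
Proof. by rewrite -(scale0r w) dotrZl mul0r. Qed.

Lemma dotr0r (K : realType) (n : nat) (w : 'rV[K]_n) : dotr w 0 = 0.
Proof. by rewrite dotrC dotr0l. Qed.

Lemma dotr_ge0 (K : realType) (n : nat) (u : 'rV[K]_n) : 0 <= dotr u u.
Proof. by apply: sumr_ge0 => i _; rewrite -expr2 sqr_ge0. Qed.

Lemma dotr_gt0 (K : realType) (n : nat) (u : 'rV[K]_n) :
  (0 < dotr u u) = (u != 0).
Proof.
rewrite lt0r dotr_ge0 andbT; congr (~~ _).
apply/eqP/eqP => [uu0|->]; last by rewrite dotr0l.
apply/rowP => i; rewrite mxE; apply/eqP.
have := psumr_eq0P (fun j (_ : true) => sqr_ge0 (u 0 j)).
rewrite (eq_bigr (fun i => u 0 i * u 0 i)) // => /(_ uu0 i isT) /eqP.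
by rewrite sqrf_eq0.
Qed.

(** * Random sign vectors *)

Definition sign_vector (K : realType) (n : nat) (e : {ffun 'I_n -> bool}) :
  'rV[K]_n := \row_i (-1) ^+ e i.

Lemma dotr_sign_vector (K : realType) (n : nat) (e : {ffun 'I_n -> bool}) :
  dotr (sign_vector K e) (sign_vector K e) = n%:R.
Proof.
rewrite /dotr (eq_bigr (fun=> 1)) => [|i _]; last by rewrite mxE -signr_addb addbb.
by rewrite sumr_const card_ord.
Qed.

(** The sub-Gaussian bound for one random sign. The sharp exponent is
    [x ^+ 2 / 2]; the constant 2 can be had from [1 + y <= expR y] alone: for
    small [x] the sum is at most [2 / (1 - x ^+ 2)], and for large [x] each term
    is below the bound since [`|x| <= 2 * x ^+ 2]. *)
Lemma expR_addN_le (K : realType) (x : K) :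
  expR x + expR (- x) <= 2 * expR (2 * x ^+ 2).
Proof.
have e1 := expR_ge1Dx (2 * x ^+ 2).
have [x2|x2] := lerP (x ^+ 2) (1 / 2); last first.
  have h1 : expR x <= expR (2 * x ^+ 2) by rewrite ler_expR; nra.
  have h2 : expR (- x) <= expR (2 * x ^+ 2) by rewrite ler_expR; nra.
  lra.
have le_inv (y : K) : 0 < 1 - y -> expR y <= (1 - y)^-1.
  move=> y1; rewrite -[y in expR y]opprK expRN lef_pV2 ?posrE ?expR_gt0//.
  exact: expR_ge1Dx.
have p1 : 0 < 1 - x by nra.
have p2 : 0 < 1 - - x by nra.
have h1 := le_inv _ p1; have h2 := le_inv _ p2.
have p3 : 0 < 1 - x ^+ 2 by lra.
have E : (1 - x)^-1 + (1 - - x)^-1 = 2 * (1 - x ^+ 2)^-1.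
  by field; rewrite !gt_eqF//= -?expr2; lra.
have h3 : (1 - x ^+ 2)^-1 <= 1 + 2 * x ^+ 2.
  rewrite -div1r ler_pdivrMr//; nra.
lra.
Qed.

(** The moment generating function of [dotr a e], for [e] a uniform sign vector:
    the coordinates are independent, so the sum over [e] is a product of
    two-term sums. *)
Lemma sum_expR_sign_vector (K : realType) (n : nat) (l : K) (a : 'rV[K]_n) :
  \sum_(e : {ffun 'I_n -> bool}) expR (l * dotr a (sign_vector K e)) <=
  2 ^+ n * expR (2 * l ^+ 2 * dotr a a).
Proof.
rewrite (eq_bigr (fun e : {ffun 'I_n -> bool} =>
  \prod_i expR (l * (a 0 i * (-1) ^+ e i)))) => [|e _]; last first.
  by rewrite mulr_sumr expR_sum; apply: eq_bigr => i _; rewrite mxE.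
rewrite -(bigA_distr_bigA (fun (i : 'I_n) (b : bool) => expR (l * (a 0 i * (-1) ^+ b)))).
have -> : 2 ^+ n = \prod_(i < n) 2 :> K by rewrite prodr_const card_ord.
rewrite mulr_sumr expR_sum -big_split/=; apply: ler_prod => i _.
rewrite big_bool/= expr0 expr1 addrC mulr1 mulrN1 mulrN.
rewrite addr_ge0 ?expR_ge0//=.
apply: le_trans (expR_addN_le _) _.
by rewrite exprMn -expr2 mulrA.
Qed.

(** Chernoff bound and union bound in one: a sign vector for which some [a] in
    [A] reaches [t] contributes at least 1 to this sum, so at most a third of all
    sign vectors do. The value of [l] minimizes the exponent
    [2 * l ^+ 2 * alpha ^+ 2 - l * t], whose minimum [- t ^+ 2 / (8 * alpha ^+ 2)]
    equals [- ln (3 * size A)] by the choice of [t]. *)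
Lemma sum_sign_tail (K : realType) (n : nat) (A : seq 'rV[K]_n) (alpha l t : K) :
  (0 < size A)%N -> 0 < alpha -> {in A, forall a, dotr a a <= alpha ^+ 2} ->
  t = alpha * Num.sqrt (8 * ln (3 * (size A)%:R)) -> l = t / (4 * alpha ^+ 2) ->
  \sum_(e : {ffun 'I_n -> bool}) \sum_(a <- A)
    expR (l * (dotr a (sign_vector K e) - t)) <= 2 ^+ n / 3.
Proof.
move=> A0 al0 hA tE lE; rewrite exchange_big/=.
have N0 : 0 < 3 * (size A)%:R :> K by rewrite mulr_gt0// ltr0n.
have N1 : 1 <= 3 * (size A)%:R :> K.
  by rewrite -natrM ler1n muln_gt0.
have t2 : t ^+ 2 = alpha ^+ 2 * (8 * ln (3 * (size A)%:R)).
  by rewrite tE exprMn sqr_sqrtr// mulr_ge0// ln_ge0.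
have bound a : a \in A -> \sum_(e : {ffun 'I_n -> bool})
    expR (l * (dotr a (sign_vector K e) - t)) <= 2 ^+ n / (3 * (size A)%:R).
  move=> aA; under eq_bigr do rewrite mulrBr expRD.
  rewrite -mulr_suml.
  apply: le_trans (ler_wpM2r (expR_ge0 _) (sum_expR_sign_vector l a)) _.
  rewrite -[leLHS]mulrA -expRD ler_pM2l ?exprn_gt0//.
  have -> : (3 * (size A)%:R)^-1 = expR (- ln (3 * (size A)%:R)) :> K.
    by rewrite expRN lnK.
  rewrite ler_expR.
  apply: (@le_trans _ _ (2 * l ^+ 2 * alpha ^+ 2 - l * t)).
    by rewrite lerD2r ler_wpM2l ?hA// mulr_ge0// sqr_ge0.
  have -> : 2 * l ^+ 2 * alpha ^+ 2 - l * t = - (t ^+ 2 / (8 * alpha ^+ 2)).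
    by rewrite lE; field; rewrite gt_eqF.
  rewrite t2 lerN2 le_eqVlt; apply/orP; left; apply/eqP.
  by field; rewrite gt_eqF.
apply: (@le_trans _ _ (\sum_(a <- A) 2 ^+ n / (3 * (size A)%:R))).
  by rewrite big_seq [leRHS]big_seq; apply: ler_sum => a /bound.
rewrite big_const_seq count_predT iter_addr_0 -[_ *+ size A]mulr_natr.
by rewrite invfM mulrA mulfVK// pnatr_eq0 -lt0n.
Qed.

(** Each of the two families excludes at most a third of the sign vectors. *)
Lemma exists_sign_vector_lt (K : realType) (n : nat) (A B : seq 'rV[K]_n) (alpha beta : K) :
  (0 < size A)%N -> (0 < size B)%N -> 0 < alpha -> 0 < beta ->
  {in A, forall a, dotr a a <= alpha ^+ 2} ->
  {in B, forall b, dotr b b <= beta ^+ 2} ->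
  exists e : {ffun 'I_n -> bool},
   {in A, forall a, dotr a (sign_vector K e) < alpha * Num.sqrt (8 * ln (3 * (size A)%:R))} /\
   {in B, forall b, dotr b (sign_vector K e) < beta * Num.sqrt (8 * ln (3 * (size B)%:R))}.
Proof.
move=> A0 B0 al0 be0 hA hB.
set t := alpha * _; set s := beta * _.
have t0 : 0 <= t by rewrite mulr_ge0 ?sqrtr_ge0// ltW.
have s0 : 0 <= s by rewrite mulr_ge0 ?sqrtr_ge0// ltW.
have lt_l : 0 <= t / (4 * alpha ^+ 2) by rewrite divr_ge0// mulr_ge0// sqr_ge0.
have lt_m : 0 <= s / (4 * beta ^+ 2) by rewrite divr_ge0// mulr_ge0// sqr_ge0.
have := sum_sign_tail A0 al0 hA (erefl t) (erefl _).
have := sum_sign_tail B0 be0 hB (erefl s) (erefl _).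
move: lt_l lt_m; set l := t / _; set m := s / _ => l0 m0 sumB sumA.
apply: contrapT => noe.
suff : 2 ^+ n <= 2 ^+ n / 3 + 2 ^+ n / 3 :> K.
  have : 0 < 2 ^+ n :> K by rewrite exprn_gt0.
  lra.
apply: le_trans (lerD sumA sumB).
rewrite -big_split/=.
have -> : 2 ^+ n = \sum_(e : {ffun 'I_n -> bool}) 1 :> K.
  by rewrite sumr_const card_ffun card_bool card_ord natrX.
have pos (C : seq 'rV[K]_n) k r e :
    0 <= \sum_(a <- C) expR (k * (dotr a (sign_vector K e) - r)).
  by apply: sumr_ge0 => *; exact: expR_ge0.
have big1 (C : seq 'rV[K]_n) k r e a : 0 <= k -> a \in C -> r <= dotr a (sign_vector K e) ->
    1 <= \sum_(a <- C) expR (k * (dotr a (sign_vector K e) - r)).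
  move=> k0 aC ra; rewrite (big_rem a)//=.
  apply: (@le_trans _ _ (expR (k * (dotr a (sign_vector K e) - r)))).
    by rewrite -[X in X <= _]expR0 ler_expR mulr_ge0// subr_ge0.
  by rewrite lerDl pos.
apply: ler_sum => e _.
have [/hasP[a aA ta]|/hasPn nA] := boolP (has (fun a => t <= dotr a (sign_vector K e)) A).
  by apply: le_trans (big1 _ _ _ _ _ l0 aA ta) _; rewrite lerDl pos.
have [/hasP[b bB sb]|/hasPn nB] := boolP (has (fun a => s <= dotr a (sign_vector K e)) B).
  by apply: le_trans (big1 _ _ _ _ _ m0 bB sb) _; rewrite lerDr pos.
case: noe; exists e; split => [a /nA|b /nB]; by rewrite -ltNge.
Qed.

Lemma ln_triple_le (K : realType) (N : nat) : (1 < N)%N ->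
  ln (3 * N%:R : K) <= 3 * ln (N%:R).
Proof.
move=> N1; have N0 : 0 < N%:R :> K by rewrite ltr0n (leq_trans _ N1).
rewrite [leRHS]mulr_natl -lnXn// ler_ln ?posrE ?exprn_gt0 ?mulr_gt0//.
have : 2 <= N%:R :> K by rewrite ler_nat.
rewrite exprSr ler_pM2r//; nra.
Qed.

(** The analytic half of the theorem. The constant is [64 * 9]: a factor 8 from
    each tail bound and a factor 3 from each use of [ln_triple_le]. *)
Lemma ln_card_mul_ge (K : realType) (n : nat) (A B : seq 'rV[K]_n) (alpha beta : K) :
  (1 < size A)%N -> (1 < size B)%N -> 0 < alpha -> 0 < beta ->
  {in A, forall a, dotr a a <= alpha ^+ 2} ->
  {in B, forall b, dotr b b <= beta ^+ 2} ->
  (forall e : {ffun 'I_n -> bool}, exists a b, [/\ a \in A, b \in B,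
     0 <= dotr a (sign_vector K e) &
     n%:R <= dotr a (sign_vector K e) * dotr b (sign_vector K e)]) ->
  576^-1 * n%:R ^+ 2 <=
    ln (size A)%:R * ln (size B)%:R * (alpha * beta) ^+ 2.
Proof.
move=> A1 B1 al0 be0 hA hB hAB.
have [e [ltA ltB]] := exists_sign_vector_lt (ltnW A1) (ltnW B1) al0 be0 hA hB.
have [a [b [aA bB a0 le_n]]] := hAB e.
have lnp N : (1 < N)%N -> 0 <= ln (3 * N%:R : K).
  by move=> N1; rewrite ln_ge0// -natrM ler1n muln_gt0 (ltnW N1).
have LA := lnp _ A1; have LB := lnp _ B1.
have LA3 := ln_triple_le K A1; have LB3 := ln_triple_le K B1.
set ta := alpha * _ in ltA; set tb := beta * _ in ltB.
have n_le : n%:R <= ta * tb.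
  apply: le_trans le_n _.
  apply: (@le_trans _ _ (dotr a (sign_vector K e) * tb)).
    by rewrite ler_wpM2l// ltW// ltB.
  by rewrite ler_wpM2r ?mulr_ge0 ?sqrtr_ge0// ltW// ltA.
have : n%:R ^+ 2 <= (ta * tb) ^+ 2 by rewrite lerXn2r ?nnegrE// (le_trans _ n_le).
rewrite !exprMn !sqr_sqrtr ?mulr_ge0// => n2.
rewrite mulrC ler_pdivrMr//; apply: le_trans n2 _.
have -> : alpha ^+ 2 * (8 * ln (3 * (size A)%:R)) * (beta ^+ 2 * (8 * ln (3 * (size B)%:R)))
  = (64 * (alpha ^+ 2 * beta ^+ 2)) * (ln (3 * (size A)%:R) * ln (3 * (size B)%:R)) :> K by ring.
have -> : ln (size A)%:R * ln (size B)%:R * (alpha ^+ 2 * beta ^+ 2) * 576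
  = (64 * (alpha ^+ 2 * beta ^+ 2)) * (3 * ln (size A)%:R * (3 * ln (size B)%:R)) :> K by ring.
apply: ler_wpM2l; last exact: ler_pM.
by rewrite mulr_ge0// mulr_ge0// sqr_ge0.
Qed.

(** * Convex hulls of finite sets and their faces *)

Lemma enorm_sqr (K : realType) (n : nat) (x : 'rV[K]_n) :
  enorm x ^+ 2 = dotr x x.
Proof. by rewrite sqr_sqrtr// dotr_ge0. Qed.

Lemma in_dilate_unit_ball (K : realType) (n : nat) (s : K) (x : 'rV[K]_n) :
  0 < s -> dilate s (@unit_ball K n) x <-> dotr x x <= s ^+ 2.
Proof.
move=> s0; split=> [[y y1 <-]|xs].
  rewrite dotrZl dotrZr mulrA -expr2 -[leRHS]mulr1 ler_pM2l ?exprn_gt0//.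
  by rewrite -enorm_sqr expr_le1// sqrtr_ge0.
exists (s^-1 *: x); last by rewrite scalerA divff ?scale1r// gt_eqF.
rewrite /unit_ball/= /enorm -sqrtr1 ler_wsqrtr//.
rewrite dotrZl dotrZr mulrA -expr2 exprVn mulrC ler_pdivrMr ?exprn_gt0//.
by rewrite mul1r.
Qed.

Lemma convex_setI (K : realType) (n : nat) (A : set 'rV[K]_n) :
  (forall x y k, A x -> A y -> 0 < k -> k < 1 -> A (k *: x + (1 - k) *: y)) ->
  convex_set (A : set (convex_lmodType 'rV[K]_n)).
Proof.
move=> hA; apply/convex_setW => x y /set_mem Ax /set_mem Ay k k0 k1.
by apply/mem_set; exact: hA.
Qed.

(** The points strictly below a hyperplane, together with the points on it that
    lie in a convex set [C], form a convex set. With [C] a singleton this shows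
    that a face is a point; with [C] a smaller hull, that a face is spanned by
    its generators. *)
Lemma hull_supported (K : realType) (n : nat) (G C : set 'rV[K]_n) u (b : K) :
  (forall x y k, C x -> C y -> 0 < k -> k < 1 -> C (k *: x + (1 - k) *: y)) ->
  (forall s, G s -> dotr u s <= b) -> (forall s, G s -> dotr u s = b -> C s) ->
  forall x, convex_hull G x -> dotr u x <= b /\ (dotr u x = b -> C x).
Proof.
move=> cC Gb GC; apply: smallest_sub; last by move=> s Gs; split; [exact: Gb|exact: GC].
apply: convex_setI => x y k [xb xC] [yb yC] k0 k1.
rewrite dotrDr !dotrZr; split; first nra.
move=> kxy.
have xE : dotr u x = b by nra.
have yE : dotr u y = b by nra.
by apply: cC => //; [exact: xC|exact: yC].
Qed.

Lemma hull_le (K : realType) (n : nat) (G : set 'rV[K]_n) u (b : K) :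
  (forall s, G s -> dotr u s <= b) -> forall x, convex_hull G x -> dotr u x <= b.
Proof. by move=> Gb x Gx; have [] := hull_supported (C := setT) _ Gb _ Gx. Qed.

Lemma sub_hull (K : realType) (n : nat) (G : set 'rV[K]_n) : G `<=` convex_hull G.
Proof. exact: sub_gen_smallest. Qed.

Lemma hull_convex (K : realType) (n : nat) (G : set 'rV[K]_n) x y (k : K) :
  convex_hull G x -> convex_hull G y -> 0 < k -> k < 1 ->
  convex_hull G (k *: x + (1 - k) *: y).
Proof.
move=> Gx Gy k0 k1 C [cC GC].
have Cx : C x by apply: Gx.
have Cy : C y by apply: Gy.
exact: set_mem (cC _ _ (Itv01 (ltW k0) (ltW k1)) (mem_set Cx) (mem_set Cy)).
Qed.

(** A face is determined by the generators lying on it, whence the finiteness of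
    the number of faces. *)
Lemma face_hullE (K : realType) (n : nat) (S : seq 'rV[K]_n) F :
  is_face (convex_hull [set` S]) F ->
  F = convex_hull [set` [seq s <- S | `[< F s >]]].
Proof.
move=> [u [b [Pb FE]]]; apply/seteqP; split=> x.
  rewrite {1}FE => -[Px ux]; apply: (hull_supported _ _ _ Px).2 ux.
  - exact: hull_convex.
  - by move=> s Ss; apply: Pb; exact: sub_hull.
  - move=> s Ss us; apply: sub_hull => /=; rewrite mem_filter Ss andbT.
    by apply/asboolP; rewrite FE; split=> //; exact: sub_hull.
move=> Fx; rewrite FE; split.
  move: x Fx; apply: sub_smallest2r; last by move=> s/=; rewrite mem_filter => /andP[].
  by apply: convex_setI; exact: hull_convex.
have ux s : [set` [seq s <- S | `[< F s >]]] s -> dotr u s = b.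
  by rewrite /= mem_filter => /andP[/asboolP]; rewrite {1}FE => -[].
apply/eqP; rewrite eq_le; apply/andP; split.
  by apply: hull_le Fx => s /ux ->.
rewrite -lerN2 -dotrNl; apply: hull_le Fx => s /ux us.
by rewrite dotrNl us.
Qed.

Lemma finite_faces (K : realType) (n : nat) (S : seq 'rV[K]_n) :
  finite_set [set F | is_face (convex_hull [set` S]) F].
Proof.
apply: (@sub_finite_set _ _ (range (fun m : (size S).-tuple bool =>
  convex_hull [set` mask m S]))); last exact/finite_image/finite_finset.
move=> F /face_hullE FE.
exists [tuple of map (fun s => `[< F s >]) (in_tuple S)] => //=.
by rewrite -filter_mask.
Qed.

Lemma affine_hull_set1 (K : realType) (n : nat) (v : 'rV[K]_n) :
  affine_hull [set v] = [set v].
Proof.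
apply: smallest_id => x y t -> ->.
by rewrite -scalerDl addrC subrK scale1r.
Qed.

Lemma has_dim_set1 (K : realType) (n : nat) (v : 'rV[K]_n) : has_dim [set v] 0.
Proof.
exists v, 0%VS; split; first exact: dimv0.
rewrite affine_hull_set1; apply/seteqP; split=> x /=.
  by move=> ->; exists 0; rewrite ?addr0//= mem0v.
by move=> [w]; rewrite /= memv0 => /eqP -> <-; rewrite addr0.
Qed.

Lemma exists_max_seq (K : realType) (T : eqType) (f : T -> K) (s : seq T) :
  (0 < size s)%N -> exists2 x, x \in s & forall y, y \in s -> f y <= f x.
Proof.
elim: s => // a [|b s] IH _.
  by exists a; rewrite ?mem_head// => y; rewrite inE => /eqP ->.
have [//|x xs xmax] := IH.
have [ax|xa] := leP (f a) (f x).
  by exists x; [rewrite inE xs orbT|move=> y; rewrite inE => /predU1P[->//|/xmax]].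
exists a; rewrite ?mem_head// => y; rewrite inE => /predU1P[->//|/xmax yx].
by rewrite ltW// (le_lt_trans yx).
Qed.

Lemma exists_small_perturbation (K : realType) (T : eqType) (g h : T -> K) (s : seq T) :
  (forall x, x \in s -> g x < 0) ->
  exists2 d : K, 0 < d & forall x, x \in s -> g x + d * h x < 0.
Proof.
elim: s => [|a s IH] gs; first by exists 1.
have [|d d0 hd] := IH; first by move=> x xs; apply: gs; rewrite inE xs orbT.
have ga := gs a (mem_head _ _).
have h0 : 0 < 1 + `|h a| by rewrite ltr_pwDl.
have e0 : 0 < - g a / (1 + `|h a|) by rewrite divr_gt0// oppr_gt0.
exists (Num.min d (- g a / (1 + `|h a|))); first by rewrite lt_min d0.
set m := Num.min _ _.
have m0 : 0 < m by rewrite lt_min d0.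
have md : m <= d by rewrite ge_min lexx.
have me : m * (1 + `|h a|) <= - g a by rewrite -ler_pdivlMr// ge_min lexx orbT.
have ha := ler_norm (h a).
move=> x; rewrite inE => /predU1P[->|xs]; first nra.
have gx : g x < 0 by apply: gs; rewrite inE xs orbT.
have hx := hd _ xs; have [hx0|hx0] := leP (h x) 0; nra.
Qed.

(** Among the maximizers of [dotr e] in [S], take the one [v] of largest
    Euclidean norm. Then [dotr v s < dotr v v] for every other maximizer [s], so
    the form [e + d *: v] with [d > 0] small is maximal on [S] at [v] only,
    and the face it exposes is the single point [v]. *)
Lemma exists_vertex_max (K : realType) (n : nat) (S : seq 'rV[K]_n) (e : 'rV[K]_n) :
  (0 < size S)%N ->
  exists v, [/\ v \in S, forall s, s \in S -> dotr e s <= dotr e v &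
    vertices (convex_hull [set` S]) [set v]].
Proof.
move=> S0; have [v0 v0S v0max] := exists_max_seq (fun s => dotr e s) S0.
pose T := [seq s <- S | dotr e s == dotr e v0].
have T0 : (0 < size T)%N.
  by rewrite -has_predT; apply/hasP; exists v0; rewrite ?mem_filter ?eqxx.
have [v vT vmax] := exists_max_seq (fun s => dotr s s) T0.
move: (vT); rewrite mem_filter => /andP[/eqP vE vS].
exists v; split; [by []|by move=> s /v0max; rewrite vE|].
have [d d0 hd] : exists2 d : K, 0 < d & forall s, s \in [seq s <- S | dotr e s < dotr e v] ->
    dotr e (s - v) + d * dotr v (s - v) < 0.
  apply: exists_small_perturbation => s; rewrite mem_filter => /andP[ev _].
  by rewrite dotrDr dotrNr subr_lt0.
pose u := e + d *: v.
have uv s : s \in S -> s != v -> dotr u s < dotr u v.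
  move=> sS sv; rewrite -subr_lt0 -dotrNr -dotrDr dotrDl dotrZl.
  have [lt_e|] := boolP (dotr e s < dotr e v); first by apply: hd; rewrite mem_filter lt_e.
  rewrite -leNgt vE => ge_e; have eE : dotr e s = dotr e v0.
    by apply/eqP; rewrite eq_le ge_e v0max.
  have sT : s \in T by rewrite mem_filter eE eqxx.
  (* [0 < `|s - v|^2] and [`|s|^2 <= `|v|^2] give [dotr v s < dotr v v]. *)
  have := vmax _ sT; have : 0 < dotr (s - v) (s - v) by rewrite dotr_gt0 subr_eq0.
  rewrite !(dotrDl, dotrDr, dotrNl, dotrNr) (dotrC s v) vE eE.
  by nra.
have ule s : [set` S] s -> dotr u s <= dotr u v.
  by move=> /= sS; have [->//|/uv] := eqVneq s v; move/(_ sS)/ltW.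
split; last exact: has_dim_set1.
exists u, (dotr u v); split; first exact: hull_le.
apply/seteqP; split=> [x ->|x [Px ux]]; first by split=> //; exact: sub_hull.
apply: (hull_supported _ _ _ Px).2 ux => //.
  by move=> y z k -> -> _ _; rewrite -scalerDl addrC subrK scale1r.
move=> s sS us; apply/eqP; apply: contraT => /(uv _ sS).
by rewrite us ltxx.
Qed.

(** * The polar and the facets *)

Definition polar (K : realType) (n : nat) (S : seq 'rV[K]_n) : set 'rV[K]_n :=
  [set u | forall s, s \in S -> dotr u s <= 1].

(** Extreme points of the polar, in the algebraic form: only 0 is orthogonal to
    all the constraints active at [u], that is, these span the whole space. *)
Definition polar_vertex (K : realType) (n : nat) (S : seq 'rV[K]_n) : set 'rV[K]_n :=
  [set u | polar S u /\ forall w : 'rV[K]_n,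
     (forall s, s \in S -> dotr u s = 1 -> dotr w s = 0) -> w = 0].

Definition dual_face (K : realType) (n : nat) (S : seq 'rV[K]_n) (u : 'rV[K]_n) :=
  convex_hull [set` S] `&` [set x | dotr u x = 1].

Lemma polar_vertex_inj (K : realType) (n : nat) (S : seq 'rV[K]_n) u v :
  polar_vertex S u -> dual_face S u = dual_face S v -> u = v.
Proof.
move=> [_ uS] uv; apply/eqP; rewrite -subr_eq0; apply/eqP/uS => s sS us.
have : dual_face S u s by split=> //; exact: sub_hull.
by rewrite uv => -[_ /= vs]; rewrite dotrDl dotrNl us vs subrr.
Qed.

Lemma ltn_in_count (T : eqType) (a1 a2 : pred T) (s : seq T) (x : T) :
  {in s, forall y, a1 y -> a2 y} -> x \in s -> a2 x -> ~~ a1 x ->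
  (count a1 s < count a2 s)%N.
Proof.
move=> a12 xs a2x a1x; rewrite -(size_filter a2) -(count_predC a1).
rewrite (@eq_in_count _ a1 (predI a1 a2)) => [|y ys]; last first.
  by rewrite /=; case a1y: (a1 y) => //=; rewrite a12.
rewrite -count_filter -[ltnLHS]addn0 ltn_add2l -has_count.
by apply/hasP; exists x; rewrite //= mem_filter a2x.
Qed.

(** While the active constraints do not span, move along a direction [w]
    orthogonal to all of them that does not decrease [dotr e], until a further
    constraint becomes active; this happens since some [s] in [S] has
    [0 < dotr w s]. The induction is on the number of inactive constraints. *)
Lemma exists_polar_vertex (K : realType) (n : nat) (S : seq 'rV[K]_n) (u e : 'rV[K]_n) :
  (forall w, w != 0 -> exists2 s, s \in S & 0 < dotr w s) -> polar S u ->
  exists2 v, polar_vertex S v & dotr u e <= dotr v e.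
Proof.
move=> posS; have [m] := ubnP (count (fun s => dotr u s != 1) S).
elim: m u => // m IH u; rewrite ltnS => um uS.
have [rigid|] := pselect (forall w : 'rV[K]_n,
    (forall s, s \in S -> dotr u s = 1 -> dotr w s = 0) -> w = 0).
  by exists u.
move=> /existsNP[w0 /not_implyP[w0S /eqP w0n]].
have [w [wn wS we]] : exists w, [/\ w != 0,
    forall s, s \in S -> dotr u s = 1 -> dotr w s = 0 & 0 <= dotr w e].
  have [?|?] := leP 0 (dotr w0 e); first by exists w0.
  exists (- w0); rewrite oppr_eq0 dotrNl oppr_ge0 ltW//; split=> // s sS us.
  by rewrite dotrNl w0S// oppr0.
pose T := [seq s <- S | 0 < dotr w s].
have T0 : (0 < size T)%N.
  have [s sS ws] := posS w wn.
  by rewrite -has_predT; apply/hasP; exists s; rewrite ?mem_filter ?ws.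
have [s1 s1T s1max] := exists_max_seq (fun s => - ((1 - dotr u s) / dotr w s)) T0.
move: (s1T); rewrite mem_filter => /andP[ws1 s1S].
pose t := (1 - dotr u s1) / dotr w s1.
have t0 : 0 <= t by rewrite divr_ge0 ?subr_ge0 ?uS// ltW.
have dE s : dotr (u + t *: w) s = dotr u s + t * dotr w s by rewrite dotrDl dotrZl.
have [] := IH (u + t *: w).
- apply: leq_trans um; apply: (@ltn_in_count _ _ _ _ s1) => //.
  + move=> s sS; apply: contra => /eqP us; rewrite dE us wS// mulr0 addr0//.
  + by apply: contraTneq ws1 => us1; rewrite wS ?ltxx.
  + by rewrite negbK dE divfK ?(gt_eqF ws1)// subrKC.
- move=> s sS; rewrite dE; have us := uS s sS.
  have [ws|ws] := leP (dotr w s) 0; first nra.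
  rewrite addrC -lerBrDr -ler_pdivlMr// -lerN2; apply: s1max.
  by rewrite mem_filter ws.
- move=> v vS ve; exists v => //; apply: le_trans ve.
  by rewrite dE lerDl mulr_ge0.
Qed.

(** The active generators [a`_i] span the space, so each [w] is a combination
    of them, with coefficients of sum [dotr u w]. For [w] orthogonal to [u] this
    sum is 0, so [w] is also a combination of the differences [a`_i - a`_0].
    Hence the affine hull of the face is the whole hyperplane
    [dotr u x = 1]. *)
Lemma dual_face_facet (K : realType) (n : nat) (S : seq 'rV[K]_n) u :
  (0 < n)%N -> polar_vertex S u -> facets (convex_hull [set` S]) (dual_face S u).
Proof.
move=> n0 [uS rigid]; split.
  by exists u, 1; split=> //; apply: hull_le.
exists n.-1; first exact: prednK.
pose a := [seq s <- S | dotr u s == 1].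
pose M : 'M[K]_(size a, n) := \matrix_(i < size a) a`_i.
have Mfull : row_full M.
  rewrite /row_full -mxrank_tr; apply: inj_row_free => v vM; apply: rigid => s sS us.
  have sa : s \in a by rewrite mem_filter us eqxx.
  have ia : (index s a < size a)%N by rewrite index_mem.
  have /rowP/(_ (Ordinal ia)) := vM; rewrite !mxE => <-.
  by apply: eq_bigr => j _; rewrite !mxE /= nth_index.
have aF i : (i < size a)%N -> dual_face S u a`_i.
  move=> /(mem_nth 0); rewrite -/a mem_filter => /andP[/eqP us sS].
  by split=> //; exact: sub_hull.
have span w : exists c : 'rV_(size a), w = \sum_i c 0 i *: a`_i.
  have /submxP[c ->] : (w <= M)%MS by exact: submx_full.
  exists c; rewrite mulmx_sum_row; apply: eq_bigr => i _.
  by rewrite rowK.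
have a0 : (0 < size a)%N.
  rewrite lt0n; apply/negP => /eqP/size0nil a0.
  have /rowP/(_ (Ordinal n0))/eqP : const_mx 1 = 0 :> 'rV[K]_n.
    apply: rigid => s sS us; suff : s \in a by rewrite a0.
    by rewrite mem_filter us eqxx.
  by rewrite !mxE oner_eq0.
set s0 := a`_0; have us0 : dotr u s0 = 1 by have [] := aF _ a0.
(* [W] is the hyperplane orthogonal to [u]. *)
pose W : {vspace 'rV[K]_n} := lker (linfun (mulmxr u^T)).
have WE w : (w \in W) = (dotr u w == 0).
  rewrite memv_ker lfunE/= dotrC; apply/eqP/eqP => [/rowP/(_ 0)|w0].
    by rewrite !mxE => <-; apply: eq_bigr => i _; rewrite mxE.
  apply/rowP => i; rewrite !mxE -[RHS]w0; apply: eq_bigr => j _.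
  by rewrite mxE ord1.
exists s0, W; split.
  have := limg_ker_dim (linfun (mulmxr u^T : 'rV[K]_n -> 'rV[K]_1)) fullv.
  rewrite capfv dimvf /dim/= mul1n -/W => dimWE.
  suff : \dim (limg (linfun (mulmxr u^T : 'rV[K]_n -> 'rV[K]_1))) = 1%N.
    by move=> dim1; rewrite dim1 addn1 in dimWE *; move: dimWE => /(congr1 predn).
  apply/eqP; rewrite eqn_leq lt0n dimv_eq0; apply/andP; split.
    by apply: leq_trans (dimvS (subvf _)) _; rewrite dimvf.
  apply/eqP => img0; have : s0 \in W by rewrite memv_ker -memv0 -img0 memv_img ?memvf.
  by rewrite WE us0 oner_eq0.
have HE x : [set s0 + w | w in [set` W]] x <-> dotr u x = 1.
  split=> [[w /=]|ux].
    by rewrite WE => /eqP uw <-; rewrite dotrDr us0 uw addr0.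
  by exists (x - s0); rewrite /= ?WE ?subrKC// dotrDr dotrNr ux us0 subrr.
apply/seteqP; split.
  apply: smallest_sub => [x y t /HE ux /HE uy|x [_ ux]]; apply/HE => //.
  by rewrite dotrDr !dotrZr ux uy; ring.
move=> _ [w /= wW <-] A [affA FA].
have As0 : A s0 by apply: FA; exact: aF.
have AZ k v : A (s0 + v) -> A (s0 + k *: v).
  move=> Av; have := affA _ _ k Av As0.
  by rewrite scalerDr scalerBl scale1r addrAC addrCA subrr addr0 addrC.
have AD v1 v2 : A (s0 + v1) -> A (s0 + v2) -> A (s0 + (v1 + v2)).
  move=> /(AZ 2) A1 /(AZ 2) A2; have := affA _ _ 2^-1 A1 A2.
  suff -> : 2^-1 *: (s0 + 2 *: v1) + (1 - 2^-1) *: (s0 + 2 *: v2) = s0 + (v1 + v2) by [].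
  by apply/rowP => i; rewrite !mxE; field.
have [c wE] := span w.
have c0 : \sum_i c 0 i = 0.
  move: wW; rewrite WE wE => /eqP uw0; rewrite -[RHS]uw0.
  rewrite (big_morph _ (fun x y => dotrDr x y u) (dotr0r u)).
  by apply: eq_bigr => i _; rewrite dotrZr (aF _ (ltn_ord i)).2 mulr1.
have -> : w = \sum_i c 0 i *: (a`_i - s0).
  under eq_bigr do rewrite scalerBr.
  by rewrite sumrB -scaler_suml c0 scale0r subr0.
apply: (big_ind (fun v => A (s0 + v))) => [|//|i _]; first by rewrite addr0.
by apply: AZ; rewrite subrKC; apply: FA; exact: aF.
Qed.

(** * Vertices against facet normals *)

Lemma exists_ball_direction (K : realType) (n : nat) (r : K) (w : 'rV[K]_n) :
  0 < r -> w != 0 ->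
  exists2 x, dilate r (@unit_ball K n) x & dotr w x = r * enorm w.
Proof.
move=> r0 w0; have ew : 0 < enorm w by rewrite sqrtr_gt0 dotr_gt0.
exists ((r / enorm w) *: w).
  apply/in_dilate_unit_ball => //.
  by rewrite dotrZl dotrZr -enorm_sqr mulrA -expr2 expr_div_n divfK// expf_neq0 ?gt_eqF.
by rewrite dotrZr -enorm_sqr expr2 mulrA divfK// gt_eqF.
Qed.

Lemma exists_dotr_gt0 (K : realType) (n : nat) (S : seq 'rV[K]_n) (r : K) (w : 'rV[K]_n) :
  0 < r -> dilate r (@unit_ball K n) `<=` convex_hull [set` S] -> w != 0 ->
  exists2 s, s \in S & 0 < dotr w s.
Proof.
move=> r0 rS w0; have [x /rS Sx wx] := exists_ball_direction r0 w0.
have [/hasP//|/hasPn nS] := boolP (has (fun s => 0 < dotr w s) S).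
have : dotr w x <= 0 by apply: hull_le Sx => s /= /nS; rewrite -leNgt.
by rewrite wx leNgt mulr_gt0// sqrtr_gt0 dotr_gt0.
Qed.

(** Test [u] against the point of the ball of radius [r] in its own direction. *)
Lemma polar_norm_le (K : realType) (n : nat) (S : seq 'rV[K]_n) (r : K) u :
  0 < r -> dilate r (@unit_ball K n) `<=` convex_hull [set` S] -> polar S u ->
  dotr u u <= r^-1 ^+ 2.
Proof.
move=> r0 rS uS; have [->|u0] := eqVneq u 0; first by rewrite dotr0l sqr_ge0.
have [x /rS Sx ux] := exists_ball_direction r0 u0.
have : r * enorm u <= 1 by rewrite -ux; apply: hull_le Sx.
rewrite -enorm_sqr mulrC -ler_pdivlMr// div1r => ur.
by rewrite lerXn2r// nnegrE ?sqrtr_ge0// invr_ge0 ltW.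
Qed.

(** The maximum of [dotr e] over a body times its maximum over the polar body
    is at least [dotr e e]; both maxima are realized here by extreme points. *)
Lemma exists_vertex_facet (K : realType) (n : nat) (S : seq 'rV[K]_n) (r : K) (e : 'rV[K]_n) :
  0 < r -> dilate r (@unit_ball K n) `<=` convex_hull [set` S] -> e != 0 ->
  exists v u, [/\ vertices (convex_hull [set` S]) [set v], polar_vertex S u,
    0 < dotr v e & dotr e e <= dotr v e * dotr u e].
Proof.
move=> r0 rS e0; have posS w := exists_dotr_gt0 (w := w) r0 rS.
have [s sS es] := posS e e0.
have [|v [vS vmax vV]] := exists_vertex_max e (S := S); first by case: (S) sS.
have ve : 0 < dotr v e by rewrite dotrC; apply: lt_le_trans es (vmax _ sS).
(* [e / dotr v e] belongs to the polar, since [v] maximizes [dotr e]. *)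
have [|u uS ue] := @exists_polar_vertex _ _ S ((dotr v e)^-1 *: e) e posS.
  by move=> x xS; rewrite dotrZl mulrC ler_pdivrMr// mul1r (dotrC v) vmax.
exists v, u; split=> //.
by rewrite mulrC -ler_pdivrMr// mulrC -dotrZl.
Qed.

Lemma size_gt1 (T : eqType) (s : seq T) (x y : T) :
  x \in s -> y \in s -> x != y -> (1 < size s)%N.
Proof.
case: s => [//|a [|//]]; rewrite !inE => /eqP-> /eqP->.
by rewrite eqxx.
Qed.

Theorem theorem1p1 (K : realType) :
  exists c : K, 0 < c /\
    forall (n : nat) (r R : K) (P : set 'rV[K]_n),
      0 < r -> 0 < R -> is_polytope P ->
      dilate r (@unit_ball K n) `<=` P -> P `<=` dilate R (@unit_ball K n) ->
      ln ((ncard (vertices P))%:R : K) * ln ((ncard (facets P))%:R : K)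
        * (R / r) ^+ 2 >= c * n%:R ^+ 2.
Proof.
exists 576^-1; split; first by rewrite invr_gt0.
move=> n r R P r0 R0 [[S0 /finite_seqP[S ->] ->] _] rP PR.
have [nE|n0] := posnP n.
  have ln0 (m : nat) : 0 <= ln (m%:R : K).
    by case: m => [|m]; [rewrite ln0|rewrite ln_ge0// ler1n].
  by rewrite [in leLHS]nE expr0n mulr0 mulr_ge0 ?sqr_ge0// mulr_ge0.
move: rP PR; set P0 := convex_hull _ => rP PR.
have finV : finite_set (vertices P0).
  by apply: sub_finite_set (finite_faces S) => F [].
have finF : finite_set (facets P0).
  by apply: sub_finite_set (finite_faces S) => F [].
(* Each vertex is replaced by its point and each facet by its normal; the
   default value 0 of [xget] is harmless as it satisfies the norm bounds. *)
pose point (F : set 'rV[K]_n) := xget 0 [set v | P0 v /\ F = [set v]].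
pose normal (F : set 'rV[K]_n) := xget 0 [set u | polar_vertex S u /\ F = dual_face S u].
pose A := [seq point F | F <- fset_set (vertices P0)].
pose B := [seq normal F | F <- fset_set (facets P0)].
have memA v : vertices P0 [set v] -> v \in A.
  move=> vV; apply/mapP; exists [set v]; first by rewrite in_fset_set// inE.
  have Pv : P0 v by have [[u [b [_ vE]]] _] := vV; have : [set v] v by []; rewrite vE => -[].
  have [_ vE] : [set w | P0 w /\ [set v] = [set w]] (point [set v]) by apply: xgetPex; exists v.
  by have : [set v] v by []; rewrite {1}vE.
have memB u : polar_vertex S u -> u \in B.
  move=> uS; apply/mapP; exists (dual_face S u).
    by rewrite in_fset_set// inE; exact: dual_face_facet.
  have [_ uE] : [set w | polar_vertex S w /\ dual_face S u = dual_face S w]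
      (normal (dual_face S u)) by apply: xgetPex; exists u.
  exact: polar_vertex_inj uE.
have AB (z : 'rV[K]_n) : dotr z z = n%:R ->
    exists a b, [/\ a \in A, b \in B, 0 < dotr a z & n%:R <= dotr a z * dotr b z].
  move=> zz; have z0 : z != 0 by rewrite -dotr_gt0 zz ltr0n.
  have [v [u [vV uS vz vuz]]] := exists_vertex_facet r0 rP z0.
  by exists v, u; split; [exact: memA|exact: memB| |rewrite -zz].
(* A sign vector and its opposite need different vertices and different
   normals. *)
have sizes : (1 < size A)%N /\ (1 < size B)%N.
  pose z := sign_vector K [ffun _ : 'I_n => false].
  have zz : dotr z z = n%:R by exact: dotr_sign_vector.
  have nz : 0 < n%:R :> K by rewrite ltr0n.
  have pos (a b : 'rV[K]_n) y : 0 < dotr a y -> n%:R <= dotr a y * dotr b y -> 0 < dotr b y.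
    by move=> ay /(lt_le_trans nz); rewrite pmulr_rgt0.
  have [a [b [aA bB az /(pos _ _ _ az) bz]]] := AB z zz.
  have [|a' [b' [aA' bB' az' /(pos _ _ _ az') bz']]] := AB (- z).
    by rewrite dotrNl dotrNr opprK.
  have ne (x y : 'rV[K]_n) : 0 < dotr x z -> 0 < dotr y (- z) -> x != y.
    by move=> xz; apply: contraTneq => <-; rewrite dotrNr oppr_gt0 -leNgt ltW.
  by split; [apply: size_gt1 aA aA' _|apply: size_gt1 bB bB' _]; exact: ne.
have := @ln_card_mul_ge K n A B R r^-1 sizes.1 sizes.2 R0.
rewrite invr_gt0 !size_map; apply => //.
- move=> _ /mapP[F _ ->]; rewrite /point; case: xgetP => [v _ [Pv _]|_].
    by apply/in_dilate_unit_ball => //; exact: PR.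
  by rewrite dotr0l sqr_ge0.
- move=> _ /mapP[F _ ->]; rewrite /normal; case: xgetP => [u _ [[uS _] _]|_].
    exact: polar_norm_le uS.
  by rewrite dotr0l sqr_ge0.
- move=> e; have [a [b [aA bB /ltW ae abe]]] := AB _ (dotr_sign_vector K e).
  by exists a, b.
Qed.
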